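(* Suppose that the full system with disturbance $\dot z=f(z,u,d)$, $z=(z_1,z_2,z_c)$, decomposes into the form $\dot z_1=f_1(z_1,z_c,u,d)$, $\dot z_2=f_2(z_2,z_c,u,d)$, $\dot z_c=f_c(z_c,u,d)$. Let $t<0$. If the target sets satisfy $\mathcal T=\mathrm{proj}_1^{-1}(\mathcal T_1)\cup \mathrm{proj}_2^{-1}(\mathcal T_2)$, then the maximal backward reachable sets satisfy $$\mathcal R(t)\supseteq\mathrm{proj}_1^{-1}(\mathcal R_1(t))\cup \mathrm{proj}_2^{-1}(\mathcal R_2(t)).$$
   Context: System: $z\in\mathbb R^n$ evolves by $\dot z=f(z,u,d)$ on $[t,0]$, $t<0$, with control $u\in\mathcal U\subset\mathbb R^{n_u}$ ($\mathcal U$ compact) and disturbance $d\in\mathcal D\subset\mathbb R^{n_d}$ (bounded); $f$ is uniformly continuous, bounded, and Lipschitz in $z$ for fixed $(u,d)$. Control functions $u(\cdot)$ and disturbance functions $d(\cdot)$ are measurable functions from $[t,0]$ to $\mathcal U$ and $\mathcal D$. $\zeta(s;z,t,u(\cdot),d(\cdot))$ is the unique trajectory equal to $z$ at time $t$. The disturbance is given by a non-anticipative strategy $\gamma\in\Gamma(t)$: a map $u(\cdot)\mapsto\gamma[u](\cdot)$ from control functions to disturbance functions such that whenever $u(r)=\hat u(r)$ for a.e. $r\in[t,s]$, then $\gamma[u](r)=\gamma[\hat u](r)$ for a.e. $r\in[t,s]$. State partition: $z=(z_1,z_2,z_c)$ with $z_i\in\mathbb R^{n_i}$, $z_c\in\mathbb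 R^{n_c}$, $n_1,n_2>0$, $n_c\ge 0$, $n_1+n_2+n_c=n$. Subsystem states are $x_i=(z_i,z_c)$, $i=1,2$. Subsystem $i$ has dynamics $\dot z_i=f_i(z_i,z_c,u,d)$, $\dot z_c=f_c(z_c,u,d)$ with trajectory $\xi_i(s;x_i,t,u(\cdot),d(\cdot))$ equal to $x_i$ at time $t$. Back-projection: for $S_i\subseteq\mathbb R^{n_i+n_c}$, $\mathrm{proj}_i^{-1}(S_i)=\{z\in\mathbb R^n:(z_i,z_c)\in S_i\}$. Target sets: $\mathcal T\subseteq\mathbb R^n$, $\mathcal T_i\subseteq\mathbb R^{n_i+n_c}$. Maximal backward reachable sets: $\mathcal R(t)=\{z:\forall\gamma\in\Gamma(t),\ \exists u(\cdot),\ \zeta(0;z,t,u(\cdot),\gamma[u](\cdot))\in\mathcal T\}$ and $\mathcal R_i(t)=\{x_i:\forall\gamma\in\Gamma(t),\ \exists u(\cdot),\ \xi_i(0;x_i,t,u(\cdot),\gamma[u](\cdot))\in\mathcal T_i\}$. *)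

(* Defs.v *)
From mathcomp Require Import all_boot all_order all_algebra.
From mathcomp Require Import all_classical all_reals all_analysis.

Set Implicit Arguments.
Unset Strict Implicit.
Unset Printing Implicit Defensive.

Import Order.TTheory GRing.Theory Num.Theory.
Import numFieldNormedType.Exports.

Local Open Scope classical_set_scope.
Local Open Scope ring_scope.

(* Functions of time are total functions on R; only their restriction to [t, 0]
   is constrained and only that restriction is ever used. R^n is 'rV[R]_n with
   its library (sup) norm. *)

(* The codomain carries the Borel sigma-algebra of R^m. As everywhere in the
   library, R carries its Borel sigma-algebra; every Lebesgue measurable
   function with values in A is almost everywhere equal to such a function. *)
Definition input_signal (R : realType) (m : nat) (t : R) (A : set 'rV[R]_m)
    (v : R -> 'rV[R]_m) : Prop :=
  measurable_fun `[t, 0]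
    (v : R -> g_sigma_algebraType (@open 'rV[R]_m)) /\
  (forall s, s \in `[t, 0] -> A (v s)).

Definition ae_eq_on (R : realType) (m : nat) (a b : R)
    (v w : R -> 'rV[R]_m) : Prop :=
  {ae (@lebesgue_measure R), forall r, r \in `[a, b] -> v r = w r}.

(* The set Gamma(t). A strategy is only constrained on control functions. *)
Definition nonanticipative (R : realType) (nu nd : nat) (t : R)
    (U : set 'rV[R]_nu) (D : set 'rV[R]_nd)
    (gamma : (R -> 'rV[R]_nu) -> (R -> 'rV[R]_nd)) : Prop :=
  (forall u, input_signal t U u -> input_signal t D (gamma u)) /\
  (forall u v s, input_signal t U u -> input_signal t U v ->
     s \in `[t, 0] -> ae_eq_on t s u v -> ae_eq_on t s (gamma u) (gamma v)).

Definition absolutely_continuous_on (R : realType) (n : nat) (a b : R)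
    (g : R -> 'rV[R]_n) : Prop :=
  forall e : R, 0 < e -> exists2 dl : R, 0 < dl &
    forall (k : nat) (p q : 'I_k -> R),
      (forall i, a <= p i /\ p i <= q i /\ q i <= b) ->
      trivIset setT (fun i => `]p i, q i[%classic) ->
      \sum_(i < k) (q i - p i) < dl ->
      \sum_(i < k) `|g (q i) - g (p i)| < e.

(* Trajectories on [t, 0] in the sense of Caratheodory; u and d being merely
   measurable, the differential equation holds almost everywhere. *)
Definition is_trajectory (R : realType) (n nu nd : nat)
    (F : 'rV[R]_n -> 'rV[R]_nu -> 'rV[R]_nd -> 'rV[R]_n)
    (z : 'rV[R]_n) (t : R) (u : R -> 'rV[R]_nu) (d : R -> 'rV[R]_nd)
    (zeta : R -> 'rV[R]_n) : Prop :=
  [/\ absolutely_continuous_on t 0 zeta,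
      zeta t = z &
      {ae (@lebesgue_measure R), forall s, s \in `[t, 0] ->
         is_derive s (1 : R) zeta (F (zeta s) (u s) (d s))}].

(* When the trajectory is unique, "some trajectory ends in T" is just "the
   trajectory ends in T". *)
Definition max_brs (R : realType) (n nu nd : nat)
    (F : 'rV[R]_n -> 'rV[R]_nu -> 'rV[R]_nd -> 'rV[R]_n)
    (U : set 'rV[R]_nu) (D : set 'rV[R]_nd) (T : set 'rV[R]_n) (t : R) :
    set 'rV[R]_n :=
  [set z | forall gamma, nonanticipative t U D gamma ->
     exists u zeta, [/\ input_signal t U u,
       is_trajectory F z t u (gamma u) zeta & T (zeta 0)]].

(* The Lipschitz constant may depend on (u, d). *)
Definition regular_dynamics (R : realType) (n nu nd : nat)
    (U : set 'rV[R]_nu) (D : set 'rV[R]_nd)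
    (f : 'rV[R]_n -> 'rV[R]_nu -> 'rV[R]_nd -> 'rV[R]_n) : Prop :=
  [/\ forall e : R, 0 < e -> exists2 dl : R, 0 < dl &
        forall z z' u u' d d', U u -> U u' -> D d -> D d' ->
          `|z - z'| < dl -> `|u - u'| < dl -> `|d - d'| < dl ->
          `|f z u d - f z' u' d'| < e,
      exists M : R, forall z u d, U u -> D d -> `|f z u d| <= M &
      forall u d, U u -> D d -> lipschitz (fun z => f z u d)].

(* A full state is z = (z1, z2, zc); a subsystem state is xi = (zi, zc). *)
Section StatePartition.
Variables (R : realType) (n1 n2 nc : nat).
Implicit Type z : 'rV[R]_(n1 + n2 + nc).

Definition part1 z : 'rV[R]_n1 := lsubmx (lsubmx z).
Definition part2 z : 'rV[R]_n2 := rsubmx (lsubmx z).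
Definition partc z : 'rV[R]_nc := rsubmx z.

Definition back_proj1 (S : set 'rV[R]_(n1 + nc)) : set 'rV[R]_(n1 + n2 + nc) :=
  [set z | S (row_mx (part1 z) (partc z))].
Definition back_proj2 (S : set 'rV[R]_(n2 + nc)) : set 'rV[R]_(n1 + n2 + nc) :=
  [set z | S (row_mx (part2 z) (partc z))].

End StatePartition.

Definition subsystem (R : realType) (ni nc nu nd : nat)
    (fi : 'rV[R]_ni -> 'rV[R]_nc -> 'rV[R]_nu -> 'rV[R]_nd -> 'rV[R]_ni)
    (fc : 'rV[R]_nc -> 'rV[R]_nu -> 'rV[R]_nd -> 'rV[R]_nc)
    (x : 'rV[R]_(ni + nc)) (u : 'rV[R]_nu) (d : 'rV[R]_nd) :
    'rV[R]_(ni + nc) :=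
  row_mx (fi (lsubmx x) (rsubmx x) u d) (fc (rsubmx x) u d).

Definition decomposes (R : realType) (n1 n2 nc nu nd : nat)
    (U : set 'rV[R]_nu) (D : set 'rV[R]_nd)
    (f : 'rV[R]_(n1 + n2 + nc) -> 'rV[R]_nu -> 'rV[R]_nd ->
         'rV[R]_(n1 + n2 + nc))
    (f1 : 'rV[R]_n1 -> 'rV[R]_nc -> 'rV[R]_nu -> 'rV[R]_nd -> 'rV[R]_n1)
    (f2 : 'rV[R]_n2 -> 'rV[R]_nc -> 'rV[R]_nu -> 'rV[R]_nd -> 'rV[R]_n2)
    (fc : 'rV[R]_nc -> 'rV[R]_nu -> 'rV[R]_nd -> 'rV[R]_nc) : Prop :=
  forall z u d, U u -> D d ->
    [/\ part1 (f z u d) = f1 (part1 z) (partc z) u d,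
        part2 (f z u d) = f2 (part2 z) (partc z) u d &
        partc (f z u d) = fc (partc z) u d].

(* Main.v *)
Require Import Defs.
From mathcomp Require Import all_boot all_order all_algebra.
From mathcomp Require Import all_classical all_reals all_analysis.
From mathcomp Require Import measurable_realfun.
From mathcomp Require Import lra.

Import Order.TTheory GRing.Theory Num.Theory.
Import numFieldNormedType.Exports.

Local Open Scope classical_set_scope.
Local Open Scope ring_scope.

(** Let xi be a subsystem trajectory driven by a control u and the disturbance
    gamma[u], starting in the projection of z and ending in the subsystem
    target. If it lifts to a trajectory of the full system from z with the same
    u and gamma[u], the full trajectory ends in the back-projection of that
    target, hence in T; since the strategies are the same for both systems, this
    gives the inclusion.

    The lift ([lift_trajectory]) overwrites the coordinates of the subsystem by
    xi and solves for the others: with g(s, y) := f(y overwritten by xi(s),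
    u(s), gamma[u](s)), a solution y of y' = g(s, y), y(t) = z, overwritten by
    xi, is a full trajectory. On the subsystem coordinates the equation holds
    because the decomposition makes those components of f depend on the
    subsystem state alone; on the others it is the equation of y. Building the
    trajectory around xi means that only existence of solutions matters. This is
    essential: the Lipschitz constants may depend on (u, d) without any
    integrability along the inputs, so no Picard-Gronwall argument applies.

    Existence ([peano_caratheodory]) is the Peano-Caratheodory theorem for a
    bounded right-hand side, measurable along measurable curves and
    equicontinuous in the state. Euler polygons solve the integral equation up
    to M h; they are equi-Lipschitz and bounded, so along an ultrafilter on the
    indices they converge pointwise, and by compactness of the time interval
    uniformly. The limit solves the integral equation, and Lebesgue
    differentiation returns to the differential equation.

    Measurability along inputs needs care because f is controlled only on
    R^n x U x D, where D need not be measurable; [coord_measurable_comp] treats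
    functions continuous relative to an arbitrary set. *)

Set Implicit Arguments.
Unset Strict Implicit.
Unset Printing Implicit Defensive.

(** * Sup norm and measurability of vector-valued functions *)

Lemma rV_norm_coord (R : realType) m (x : 'rV[R]_m) i : `|x 0 i| <= `|x|.
Proof.
rewrite [leRHS]/Num.Def.normr/= mx_normrE.
exact: (le_bigmax _ (fun ij : 'I_1 * 'I_m => `|x ij.1 ij.2|) (0, i)).
Qed.

Lemma rV_norm_le (R : realType) m (x : 'rV[R]_m) (e : R) :
  0 <= e -> (forall i, `|x 0 i| <= e) -> `|x| <= e.
Proof.
move=> e0 xe; rewrite [leLHS]/Num.Def.normr/= mx_normrE.
by apply: bigmax_le => // -[i j] _ /=; rewrite ord1.
Qed.

Lemma rV_norm_lt (R : realType) m (x : 'rV[R]_m) (e : R) :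
  0 < e -> (forall i, `|x 0 i| < e) -> `|x| < e.
Proof.
move=> e0 xe; rewrite [ltLHS]/Num.Def.normr/= mx_normrE.
by apply/bigmax_ltP; split => // -[i j] _ /=; rewrite ord1.
Qed.

Lemma rV_norm_reindex (R : realType) m k (x : 'rV[R]_m) (y : 'rV[R]_k)
    (s : 'I_m -> 'I_k) :
  (forall i, x 0 i = y 0 (s i)) -> `|x| <= `|y|.
Proof. by move=> xy; apply: rV_norm_le => // i; rewrite xy rV_norm_coord. Qed.

Definition coord_measurable (R : realType) m (D : set R) (v : R -> 'rV[R]_m) :=
  forall i, measurable_fun D (fun s => v s 0 i).

(** Coordinate projections are continuous, so preimages of intervals under
    them are open. *)
Lemma borel_coord_measurable (R : realType) m (D : set R) (v : R -> 'rV[R]_m) :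
  measurable_fun D (v : R -> g_sigma_algebraType (@open 'rV[R]_m)) ->
  coord_measurable D v.
Proof.
move=> mv i mD; apply: (measurability _ (RGenOpens.measurableE R)) => //.
move=> _ [_ [a [b ->] <-]] /=.
apply: (mv mD ((fun x : 'rV[R]_m => x 0 i) @^-1` `]a, b[%classic)).
apply: sub_sigma_algebra; apply: open_comp => [x _|]; last exact: interval_open.
exact: coord_continuous.
Qed.

(** The set where h o v > c is the union, over the countably many rational boxes
    on whose trace on A one has h > c, of the preimages of these boxes under v.
    Since only the boxes are pulled back, A itself may be non-measurable. *)
Lemma coord_measurable_comp (R : realType) m (D : set R) (A : set 'rV[R]_m)
    (v : R -> 'rV[R]_m) (h : 'rV[R]_m -> R) :
  coord_measurable D v -> (forall s, D s -> A (v s)) ->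
  (forall x, A x -> forall e : R, 0 < e -> exists2 dl : R, 0 < dl &
     forall x', A x' -> `|x' - x| < dl -> `|h x' - h x| < e) ->
  measurable_fun D (h \o v).
Proof.
move=> mv DA hc mD; apply: (measurability _ (RGenOInfty.measurableE R)) => //.
move=> _ [_ [c ->] <-] /=.
pose box (w : 'rV[rat]_m * nat) : set 'rV[R]_m :=
  [set x | forall i, `|x 0 i - ratr (w.1 0 i)| < w.2.+1%:R^-1].
pose good w := A `&` box w `<=` [set x | c < h x].
rewrite (_ : _ `&` _ =
    \bigcup_w (if pselect (good w) then D `&` v @^-1` box w else set0)).
  apply: countable_bigcupT_measurable => [|w]; first exact: countableP.
  case: pselect => gw; last exact: measurable0.
  rewrite (_ : _ `&` _ = D `&` \bigcap_(i in [set: 'I_m])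
      [set s | D s /\ `|v s 0 i - ratr (w.1 0 i)| < w.2.+1%:R^-1]).
    apply: measurableI => //; apply: fin_bigcap_measurable => // i _.
    pose J : set R := ball (ratr (w.1 0 i) : R) w.2.+1%:R^-1.
    rewrite (_ : [set s | _] = D `&` (fun s => v s 0 i) @^-1` J).
      exact: (mv i mD J (measurable_ball _ _)).
    by apply/seteqP; split=> s /= [Ds]; rewrite /J /ball/= distrC.
  apply/seteqP; split=> s /= [Ds bs]; split => // i.
  by have [] := bs i I.
apply/seteqP; split => [s [Ds /=]|s [w _]]; last first.
  case: pselect => // gw [Ds bs]; split => //=; rewrite in_itv/= andbT.
  by apply: gw; split => //; exact: DA.
rewrite in_itv/= andbT => chs.
have := hc _ (DA _ Ds) (h (v s) - c); rewrite subr_gt0 => /(_ chs)[dl dl0 hdl].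
(* a box of radius r < dl / 2 whose centre is r-close to v s stays within dl
   of v s *)
have [k [r [rk r0 rdl]]] : exists k (r : R), [/\ r = k.+1%:R^-1,
    0 < r & r < dl / 2].
  exists (Num.truncn (2 / dl)), (Num.truncn (2 / dl)).+1%:R^-1.
  split; [by []|by rewrite invr_gt0|].
  rewrite -[ltRHS]invrK ltf_pV2 ?posrE ?invr_gt0 ?divr_gt0// invf_div.
  exact: truncnS_gt.
have q_ex (i : 'I_m) : {q : rat | `|v s 0 i - ratr q| < r}.
  apply/cid; have : v s 0 i - r < v s 0 i + r by lra.
  move=> /rat_in_itvoo[q]; rewrite in_itv/= => /andP[q1 q2].
  by exists q; rewrite ltr_norml; apply/andP; split; lra.
pose q i := sval (q_ex i).
have qE i : `|v s 0 i - ratr (q i)| < r := svalP (q_ex i).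
exists (\row_i q i, k) => //; case: pselect => [|].
  by move=> gw; split => // i /=; rewrite mxE -rk.
case=> x [Ax bx] /=; have : `|x - v s| < dl.
  apply: rV_norm_lt => // i; have := bx i; have := qE i.
  rewrite /= !mxE -rk !ltr_norml => /andP[? ?] /andP[? ?]; lra.
by move/(hdl _ Ax); rewrite ltr_norml; lra.
Qed.

(** * Primitives of bounded measurable vector functions *)

Definition bounded_measurable (R : realType) (a b M : R) m
    (v : R -> 'rV[R]_m) :=
  coord_measurable `[a, b]%classic v /\
  (forall s, s \in `[a, b] -> `|v s| <= M).

(** The integrand is cut off outside [a, b] so as to be integrable on the whole
    line, which the differentiation theorem requires. *)
Definition primitive (R : realType) (a b : R) m (v : R -> 'rV[R]_m) (s : R) :
    'rV[R]_m :=
  \row_i \int[@lebesgue_measure R]_(r in `[a, s])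
    ((fun r => v r 0 i) \_ `[a, b]) r.

Lemma le_normr_Rintegral_itv (R : realType) (f : R -> R) (c s M : R)
    (k : bool) :
  c <= s ->
  (@lebesgue_measure R).-integrable
    [set` Interval (BSide k c) (BRight s)] (EFin \o f) ->
  (forall r, `|f r| <= M) ->
  `|\int[@lebesgue_measure R]_(r in [set` Interval (BSide k c) (BRight s)]) f r|
    <= M * (s - c).
Proof.
move=> cs intf fM; apply: (le_trans (le_normr_Rintegral _ intf)) => //.
set I := [set` _]; have mI : measurable I by exact: measurable_itv.
have -> : M * (s - c) = \int[@lebesgue_measure R]_(r in I) (cst M r).
  rewrite Rintegral_cst//; congr *%R.
  rewrite /I /= lebesgue_measure_itv/=.
  by move: cs; rewrite le_eqVlt => /orP[/eqP->|cs];
    rewrite lte_fin ?ltxx ?subrr// cs.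
apply: le_Rintegral => //.
- exact: integrable_norm.
- apply: measurable_bounded_integrable => //.
  + rewrite /I /= lebesgue_measure_itv/=; case: ifPn => //= _.
    by rewrite -EFinB ltry.
  + exact: bounded_cst.
Qed.

Section Primitive.
Variables (R : realType) (a b M : R) (m : nat).
Hypothesis ab : a <= b.
Implicit Types v w : R -> 'rV[R]_m.
Notation mu := (@lebesgue_measure R).

Lemma bounded_measurable_integrable v i : bounded_measurable a b M v ->
  mu.-integrable `[a, b] (EFin \o (fun r => v r 0 i)).
Proof.
move=> [mv vM]; apply: measurable_bounded_integrable => //.
- rewrite /= lebesgue_measure_itv/=; case: ifPn => //= _.
  by rewrite -EFinB ltry.
- exact: mv.
- exists M; split => [|c Mc r rab]; first exact: num_real.
  by rewrite /= (le_trans (rV_norm_coord _ _))// (le_trans (vM _ _)) ?ltW.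
Qed.

Lemma bounded_measurable_integrable_restrict v i (A : set R) :
  bounded_measurable a b M v -> measurable A ->
  mu.-integrable A (EFin \o ((fun r => v r 0 i) \_ `[a, b])).
Proof.
move=> mv mA; apply: (@integrableS _ _ _ mu setT) => //.
rewrite -restrict_EFin; apply/integrable_restrict => //; rewrite setTI.
exact: bounded_measurable_integrable.
Qed.

Lemma primitive_left v : primitive a b v a = 0.
Proof. by apply/rowP => i; rewrite !mxE set_itv1 Rintegral_set1. Qed.

Lemma eq_primitive v w s : (forall r, r \in `[a, s] -> v r = w r) ->
  primitive a b v s = primitive a b w s.
Proof.
move=> vw; apply/rowP => i; rewrite !mxE; apply: eq_Rintegral => r.
by rewrite inE => rs; rewrite !patchE vw.
Qed.

Lemma primitive_lipschitz v s s' : bounded_measurable a b M v ->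
  s \in `[a, b] -> s' \in `[a, b] ->
  `|primitive a b v s - primitive a b v s'| <= M * `|s - s'|.
Proof.
move=> mv sab s'ab.
wlog ss' : s s' sab s'ab / s <= s'.
  move=> H; have [ss'|/ltW s's] := leP s s'; first exact: H.
  by rewrite distrC [`|s - _|]distrC H.
move: sab s'ab; rewrite !in_itv/= => /andP[as_ _] /andP[_ s'b].
rewrite distrC [`|s - _|]distrC [`|s' - _|]ger0_norm ?subr_ge0//.
have [_ vM] := mv.
have M0 : 0 <= M by rewrite (le_trans (normr_ge0 (v a)))// vM// in_itv/= lexx.
apply: rV_norm_le => [|i]; first by rewrite mulr_ge0// subr_ge0.
rewrite !mxE Rintegral_itvB ?bnd_simp//; last first.
  exact: bounded_measurable_integrable_restrict.
apply: le_normr_Rintegral_itv => //.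
  exact: bounded_measurable_integrable_restrict.
move=> r; rewrite patchE; case: ifPn => [|_]; last by rewrite normr0.
by rewrite inE => rab; rewrite (le_trans (rV_norm_coord _ _))// vM.
Qed.

(** This is what passes a uniform limit under the integral sign. *)
Lemma primitive_close v w (e s : R) :
  bounded_measurable a b M v -> bounded_measurable a b M w ->
  0 <= e -> (forall r, r \in `[a, b] -> `|v r - w r| <= e) -> s \in `[a, b] ->
  `|primitive a b v s - primitive a b w s| <= e * (b - a).
Proof.
move=> mv mw e0 vw /[!in_itv]/= /andP[as_ sb].
apply: rV_norm_le => [|i]; first by rewrite mulr_ge0// subr_ge0.
rewrite !mxE -RintegralB//; try exact: bounded_measurable_integrable_restrict.
apply: (@le_trans _ _ (e * (s - a))); last by rewrite ler_wpM2l// lerD2r.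
apply: le_normr_Rintegral_itv => //.
  have := integrableB _ (bounded_measurable_integrable_restrict i mv _)
                    (bounded_measurable_integrable_restrict i mw _).
  by apply.
move=> r; rewrite !patchE; case: ifPn => [|_]; last by rewrite subr0 normr0.
rewrite inE => rab; apply: le_trans (vw _ rab).
apply: le_trans (rV_norm_coord _ i).
by rewrite !mxE.
Qed.

Lemma is_derive_rV (V : normedModType R) k (f : V -> 'rV[R]_k) (x v : V)
    (df : 'rV[R]_k) :
  (forall i, is_derive x v (fun y => f y 0 i) (df 0 i)) <-> is_derive x v f df.
Proof.
split=> [dfi|[df1 df2] i].
  have df1 : derivable f x v.
    by apply/derivable_mxP => i j; rewrite ord1; have [] := dfi j.
  apply: DeriveDef => //; rewrite derive_mx//; apply/rowP => i; rewrite mxE.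
  by have [] := dfi i.
apply: DeriveDef; first by move/derivable_mxP : df1.
by rewrite -df2 derive_mx// mxE.
Qed.

(** Lebesgue differentiation, one coordinate at a time: the finitely many
    exceptional null sets are merged into one. *)
Lemma primitive_ae_derive v : bounded_measurable a b M v ->
  {ae mu, forall s, s \in `[a, b] ->
    is_derive s (1 : R) (primitive a b v) (v s)}.
Proof.
move=> mv.
have : {ae mu, forall s, forall i : 'I_m, a < s ->
    is_derive s (1 : R) (fun r => primitive a b v r 0 i)
      (((fun r => v r 0 i) \_ `[a, b]) s)}.
  apply: filter_forall => i.
  pose f := (fun r => v r 0 i) \_ `[a, b].
  have intf (y : R) :
      mu.-integrable [set` Interval (BLeft a) (BRight y)] (EFin \o f).
    exact: bounded_measurable_integrable_restrict.
  have locf : locally_integrable [set: R] f.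
    by apply: integrable_locally => //; exact: bounded_measurable_integrable.
  have := FTC1 intf locf.
  apply: filterS; first exact: (ae_filter_ringOfSetsType mu).
  move=> s dFs as_; have [//|df1 df2] := dFs.
  rewrite (_ : (fun r => _) =
      (fun x => \int[mu]_(t in [set` Interval (BLeft a) (BRight x)]) f t)).
    by apply: DeriveDef => //; rewrite -derive1E.
  by apply/funext => r; rewrite mxE.
have ae_neq_a : {ae mu, forall s, s != a}.
  exists [set a]; split => //; first exact: lebesgue_measure_set1.
  by move=> s /= /negP; rewrite negbK => /eqP.
apply: filterS2 ae_neq_a; first exact: (ae_filter_ringOfSetsType mu).
move=> s sa dv sab; apply/is_derive_rV => i.
move: (sab); rewrite in_itv/= le_eqVlt eq_sym (negbTE sa)/= => /andP[as_ _].
by have := dv i as_; rewrite patchE mem_set.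
Qed.

End Primitive.

(** * Absolute continuity *)

(** A single interval in the definition of absolute continuity. *)
Lemma absolutely_continuous_uniform (R : realType) (a b : R) m
    (w : R -> 'rV[R]_m) :
  absolutely_continuous_on a b w ->
  forall e : R, 0 < e -> exists2 dl : R, 0 < dl &
    forall s s', s \in `[a, b] -> s' \in `[a, b] -> `|s - s'| < dl ->
      `|w s - w s'| < e.
Proof.
move=> acw e e0; have [dl dl0 wdl] := acw e e0; exists dl => //.
suff H s s' : s \in `[a, b] -> s' \in `[a, b] -> s <= s' -> `|s - s'| < dl ->
    `|w s - w s'| < e.
  move=> s s' sab s'ab; have [ss'|s's] := leP s s'; first exact: H.
  by rewrite distrC [`|w s - _|]distrC; exact/H/ltW.
rewrite !in_itv/= => /andP[as_ _] /andP[_ s'b] ss'.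
rewrite distrC ger0_norm ?subr_ge0// => sdl.
have := wdl 1%N (fun=> s) (fun=> s'); rewrite !big_ord1 distrC; apply => //.
by move=> i j _ _ _; rewrite !ord1.
Qed.

Lemma absolutely_continuous_coord_measurable (R : realType) (a b : R) m
    (w : R -> 'rV[R]_m) :
  absolutely_continuous_on a b w -> coord_measurable `[a, b]%classic w.
Proof.
move=> acw i; apply: (@subspace_continuous_measurable_fun _ `[a, b]%classic
  (fun s => w s 0 i : R)); first exact: measurable_itv.
apply/subspace_continuousP => s sab; apply/cvgrPdist_lt => /= e e0.
have [dl dl0 wdl] := absolutely_continuous_uniform acw e0.
move: (nbhsx_ballx s dl dl0); apply: (@filterS _ (nbhs s)) => s' ss' s'ab.
apply: le_lt_trans (wdl s s' sab s'ab ss').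
by apply: le_trans (rV_norm_coord _ i); rewrite !mxE.
Qed.

Lemma lipschitz_absolutely_continuous (R : realType) (a b M : R) m
    (w : R -> 'rV[R]_m) :
  (forall s s', s \in `[a, b] -> s' \in `[a, b] ->
    `|w s - w s'| <= M * `|s - s'|) ->
  absolutely_continuous_on a b w.
Proof.
move=> wM e e0; pose M' := `|M| + 1; have M'0 : 0 < M' by rewrite ltr_wpDl.
exists (e / M') => [|k p q pq _]; first exact: divr_gt0.
rewrite ltr_pdivlMr// => /(le_lt_trans _); apply; rewrite mulr_suml.
apply: ler_sum => i _; have [ap [pq' qb]] := pq i.
apply: le_trans (wM _ _ _ _) _;
  rewrite ?in_itv/= ?qb ?ap ?(le_trans ap) ?(le_trans pq')//.
rewrite ger0_norm ?subr_ge0// mulrC ler_wpM2l// ?subr_ge0//.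
by rewrite (le_trans (ler_norm _))// lerDl.
Qed.

(** * Existence of Caratheodory solutions *)

Section Peano.
Variables (R : realType) (a b M : R) (m : nat) (g : R -> 'rV[R]_m -> 'rV[R]_m).
Variable y0 : 'rV[R]_m.
Hypothesis ab : a <= b.
Hypothesis g_bounded : forall s y, s \in `[a, b] -> `|g s y| <= M.
Hypothesis g_equicontinuous : forall e : R, 0 < e -> exists2 dl : R, 0 < dl &
  forall s y y', s \in `[a, b] -> `|y - y'| < dl -> `|g s y - g s y'| < e.
Hypothesis g_measurable : forall p, coord_measurable `[a, b]%classic p ->
  coord_measurable `[a, b]%classic (fun s => g s (p s)).

Let M_ge0 : 0 <= M.
Proof.
by rewrite (le_trans (normr_ge0 (g a 0)))// g_bounded// in_itv/= lexx.
Qed.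

Let small_multiple (e : R) : 0 < e -> exists2 r, 0 < r & M * r < e.
Proof.
move=> e0; have M1 : 0 < M + 1 by rewrite ltr_wpDl.
exists (e / (M + 1)); first exact: divr_gt0.
have : e / (M + 1) * (M + 1) = e by rewrite divfK// gt_eqF.
have : 0 < e / (M + 1) by exact: divr_gt0.
lra.
Qed.

Let picard (p : R -> 'rV[R]_m) s := y0 + primitive a b (fun r => g r (p r)) s.

Let bounded_measurable_g p : coord_measurable `[a, b]%classic p ->
  bounded_measurable a b M (fun s => g s (p s)).
Proof. by move=> mp; split; [exact: g_measurable|move=> s /g_bounded]. Qed.

Let picard_lipschitz p s s' : coord_measurable `[a, b]%classic p ->
  s \in `[a, b] -> s' \in `[a, b] ->
  `|picard p s - picard p s'| <= M * `|s - s'|.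
Proof.
move=> mp sab s'ab; rewrite /picard opprD addrACA subrr add0r.
exact: (primitive_lipschitz ab (bounded_measurable_g mp)).
Qed.

(** The values of p are those of its Picard iterate at the last point a + j h, so
    the error is the increment of an M-Lipschitz function over a length at most
    h. The induction on the number of steps only changes p to the right of the
    points already treated, which leaves the primitive there unchanged. *)
Lemma euler_polygon (h : R) : 0 < h ->
  exists2 p, coord_measurable `[a, b]%classic p &
  forall s, s \in `[a, b] -> `|p s - picard p s| <= M * h.
Proof.
move=> h0.
have step j : exists2 p, coord_measurable `[a, b]%classic p &
    forall s, s \in `[a, b] -> s <= a + h *+ j -> `|p s - picard p s| <= M * h.
  elim: j => [|j [p mp ph]].
    exists (fun=> y0) => [i|s]; first exact: measurable_cst.
    rewrite in_itv/= mulr0n addr0 => /andP[as_ _] sa.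
    have -> : s = a by apply/le_anti; rewrite as_ sa.
    by rewrite /picard primitive_left addr0 subrr normr0 mulr_ge0// ltW.
  set c := a + h *+ j; have ac : a <= c by rewrite lerDl mulrn_wge0// ltW.
  have [cb|bc] := leP c b; last first.
    exists p => // s sab _; apply: ph => //.
    by move: sab; rewrite in_itv/= => /andP[_ /le_trans]; apply; exact: ltW.
  pose q s := if s <= c then p s else picard p c.
  have pq s : s <= c -> picard q s = picard p s.
    move=> sc; congr (_ + _); apply: eq_primitive => r.
    by rewrite in_itv/= => /andP[_ rs]; rewrite /q (le_trans rs).
  have mq : coord_measurable `[a, b]%classic q.
    move=> i; rewrite (_ : (fun s => q s 0 i) =
        (fun s => if s <= c then p s 0 i else picard p c 0 i)); last first.
      by apply/funext => s; rewrite /q; case: ifP.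
    apply: measurable_fun_if => //.
    - by apply: measurable_fun_ler => //; exact: measurable_cst.
    - by apply: measurable_funS (mp i) => // s [].
  exists q => // s sab sj; have [sc|cs] := leP s c.
    by rewrite pq// {1}/q sc ph.
  rewrite {1}/q (leNgt s c) cs/= -(pq c)//.
  have cab : c \in `[a, b] by rewrite in_itv/= ac.
  rewrite (le_trans (picard_lipschitz mq cab sab))// distrC.
  rewrite ger0_norm ?subr_ge0 ?(ltW cs)// ler_wpM2l// lerBlDl.
  by move: sj; rewrite mulrSr addrA.
have [p mp ph] := step (Num.truncn ((b - a) / h)).+1.
exists p => // s sab; apply: ph => //.
move: sab; rewrite in_itv/= => /andP[_ sb]; rewrite (le_trans sb)//.
rewrite -lerBlDl -mulr_natr mulrC -ler_pdivrMr//.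
exact/ltW/truncnS_gt.
Qed.

Let picard_left p : picard p a = y0.
Proof. by rewrite /picard primitive_left addr0. Qed.

(** The proof extracts a limit of Euler polygons; the ultrafilter plays the part
    of the subsequence in the theorem of Arzela and Ascoli. The witness is the
    Picard iterate of the limit: it equals the limit on [a, b] and is a
    primitive on the whole line, hence is differentiated directly. *)
Theorem peano_caratheodory : exists y : R -> 'rV[R]_m,
  [/\ absolutely_continuous_on a b y, y a = y0 &
   {ae @lebesgue_measure R, forall s, s \in `[a, b] ->
      is_derive s (1 : R) y (g s (y s))}].
Proof.
have aab : a \in `[a, b] by rewrite in_itv/= lexx.
have /choice[p /all_and2[mp pw]] : forall k, exists p,
    coord_measurable `[a, b]%classic p /\
    forall s, s \in `[a, b] -> `|p s - picard p s| <= M * k.+1%:R^-1.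
  move=> k; have [|p mp pw] := @euler_polygon k.+1%:R^-1; last by exists p.
  by rewrite invr_gt0.
pose w k := picard (p k).
have wM k s s' : s \in `[a, b] -> s' \in `[a, b] ->
    `|w k s - w k s'| <= M * `|s - s'| by exact: picard_lipschitz.
(* a fixed ultrafilter makes all the bounded sequences w k s converge at once *)
have [U [UU ooU]] := ultraFilterLemma (@eventually_filter).
have w_cvg s : s \in `[a, b] -> cvg (w ^~ s @ U).
  move=> sab; pose A := closed_ball_ Num.norm y0 (M * (b - a)).
  have cA : compact A.
    apply: bounded_closed_compact; last exact: closed_closed_ball_.
    exists (`|y0| + M * (b - a)); split => [|c /ltW cB x Ax].
      exact: num_real.
    apply: le_trans cB; rewrite -lerBlDl (le_trans _ Ax)// distrC.
    exact: lerB_dist.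
  have wA : (w ^~ s @ U) A.
    apply: (@filterS _ U _ setT); last exact: filterT.
    move=> k _; rewrite /A /closed_ball_/= -{1}(picard_left (p k)).
    rewrite (le_trans (wM _ _ _ _ _))// ler_wpM2l//.
    move: sab; rewrite in_itv/= => /andP[as_ sb].
    by rewrite distrC ger0_norm ?subr_ge0// lerD2r.
  have [l [_ lU]] := cA (w ^~ s @ U) _ wA.
  apply/cvg_ex; exists l => N lN.
  case: (in_ultra_setVsetC (w ^~ s @^-1` N) UU) => // UN.
  by have [x [nNx Nx]] := lU (~` N) N UN lN.
pose y s := lim (w ^~ s @ U).
have wy s (e : R) : s \in `[a, b] -> 0 < e ->
    \forall k \near U, `|y s - w k s| < e.
  by move=> /w_cvg/cvgrPdist_lt; apply.
have yM s s' : s \in `[a, b] -> s' \in `[a, b] ->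
    `|y s - y s'| <= M * `|s - s'|.
  move=> sab s'ab; apply/ler_addgt0Pr => e e0.
  have e20 : 0 < e / 2 by exact: divr_gt0.
  have [k [ks ks']] := filter_ex (filterI (wy s _ sab e20) (wy s' _ s'ab e20)).
  have -> : y s - y s' = (y s - w k s) + (w k s - w k s') - (y s' - w k s').
    by rewrite subrKA opprB subrKA.
  rewrite (le_trans (ler_normB _ _))//.
  rewrite (le_trans (lerD (ler_normD _ _) (lexx _)))//.
  by have := wM k s s' sab s'ab; lra.
have my : coord_measurable `[a, b]%classic y.
  apply: absolutely_continuous_coord_measurable.
  exact: lipschitz_absolutely_continuous yM.
(* equicontinuity makes the convergence locally uniform in s, and compactness of
   [a, b] makes it uniform *)
have w_unif (e : R) : 0 < e ->
    \forall k \near U, `[a, b]%classic `<=`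
      [set s | s \in `[a, b] -> `|y s - w k s| < e].
  move=> e0; have := @segment_compact R a b.
  rewrite compact_near_coveringP; apply.
  move=> s sab; have [|r r0 Mr] := small_multiple (e := e / 3).
     exact: divr_gt0.
  exists (ball s r, [set k | `|y s - w k s| < e / 3]).
    split => /=; first exact: nbhsx_ballx.
    by apply: wy => //; rewrite divr_gt0.
  move=> [s' k] /= [ss' ks] s'ab.
  have Mss : M * `|s - s'| < e / 3.
    by apply: le_lt_trans Mr; rewrite ler_wpM2l// ltW.
  have -> : y s' - w k s' = (y s - w k s) - (y s - y s') + (w k s - w k s').
    by rewrite opprB [y s - w k s + _]addrC !subrKA.
  rewrite (le_lt_trans (ler_normD _ _))//.
  rewrite (le_lt_trans (lerD (ler_normB _ _) (lexx _)))//.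
  by have := wM k s s' sab s'ab; have := yM s s' sab s'ab; lra.
(* w k is the Picard iterate of p k, which is uniformly close to w k and so to
   y; compare it with the Picard iterate of y *)
have y_picard s : s \in `[a, b] -> picard y s = y s.
  move=> sab; apply/eqP; rewrite -subr_eq0 -normr_le0.
  apply/ler_addgt0Pr => e e0.
  rewrite add0r; pose e' := e / (1 + (b - a)).
  have ba0 : 0 < 1 + (b - a) by rewrite ltr_pwDl// subr_ge0.
  have e'0 : 0 < e' by rewrite divr_gt0.
  have [dl dl0 gdl] := g_equicontinuous e'0.
  have dl20 : 0 < dl / 2 by rewrite divr_gt0.
  have : \forall k \near U, M * k.+1%:R^-1 < dl / 2.
    apply: ooU; have [r r0 Mr] := small_multiple dl20.
    have := near_infty_natSinv_lt (PosNum r0); apply: filterS => k /= /ltW kr.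
    by apply: le_lt_trans Mr; rewrite ler_wpM2l.
  move=> Uk; have [k [[ye yd] Mk]] :=
    filter_ex (filterI (filterI (w_unif _ e'0) (w_unif _ dl20)) Uk).
  have gpy r : r \in `[a, b] -> `|g r (p k r) - g r (y r)| <= e'.
    move=> rab; apply/ltW/gdl => //.
    have -> : p k r - y r = (p k r - w k r) - (y r - w k r).
      by rewrite opprB addrA subrK.
    rewrite (le_lt_trans (ler_normB _ _))//.
    by rewrite (splitr dl) ltrD ?(le_lt_trans (pw k r rab))//; exact: yd.
  have -> : picard y s - y s = - (w k s - picard y s) - (y s - w k s).
    by rewrite !opprB subrKA.
  have -> : e = e' * (b - a) + e'.
    by rewrite -[X in _ = _ + X]mulr1 -mulrDr addrC divfK// gt_eqF.
  rewrite (le_trans (ler_normB _ _))// normrN lerD ?(ltW (ye _ _ _))//.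
  rewrite /w /picard opprD addrACA subrr add0r.
  exact: (primitive_close ab (bounded_measurable_g (mp k))
           (bounded_measurable_g my) (ltW e'0)).
exists (picard y); split => //.
  apply: (lipschitz_absolutely_continuous (M := M)) => s s'.
  exact: picard_lipschitz.
have := primitive_ae_derive (bounded_measurable_g my).
apply: filterS; first exact: (ae_filter_ringOfSetsType (@lebesgue_measure R)).
move=> s dy sab; rewrite y_picard//.
have := is_deriveD (is_derive_cst y0 s 1) (dy sab); rewrite add0r.
exact.
Qed.
End Peano.

(** * Lifting subsystem trajectories to the full system *)

Section Override.
Variables (R : realType) (k n : nat) (pi : 'I_k -> 'I_n).
Implicit Types (x : 'rV[R]_k) (z : 'rV[R]_n).

Definition override x z : 'rV[R]_n :=
  \row_j if [pick i | pi i == j] is Some i then x 0 i else z 0 j.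

Lemma colsub_override x z : injective pi -> colsub pi (override x z) = x.
Proof.
move=> pi_inj; apply/rowP => i; rewrite !mxE.
by case: pickP => [i' /eqP/pi_inj ->//|/(_ i)]; rewrite eqxx.
Qed.

Lemma override_colsub z : override (colsub pi z) z = z.
Proof.
by apply/rowP => j; rewrite !mxE; case: pickP => // i /eqP <-; rewrite mxE.
Qed.

Lemma override_dist x x' z z' :
  `|override x z - override x' z'| <= Num.max `|x - x'| `|z - z'|.
Proof.
apply: rV_norm_le => [|j]; first by rewrite le_max normr_ge0.
rewrite !mxE; case: pickP => [i _|_]; rewrite le_max.
  by have := rV_norm_coord (x - x') i; rewrite !mxE => ->.
by have := rV_norm_coord (z - z') j; rewrite !mxE => ->; rewrite orbT.
Qed.

Lemma override_coord_measurable (D : set R) (x : R -> 'rV[R]_k)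
    (z : R -> 'rV[R]_n) :
  coord_measurable D x -> coord_measurable D z ->
  coord_measurable D (fun s => override (x s) (z s)).
Proof.
move=> mx mz j; under eq_fun do rewrite mxE.
by case: pickP => [i _|_]; [exact: mx|exact: mz].
Qed.

Lemma override_absolutely_continuous (a b : R) (x : R -> 'rV[R]_k)
    (z : R -> 'rV[R]_n) :
  absolutely_continuous_on a b x -> absolutely_continuous_on a b z ->
  absolutely_continuous_on a b (fun s => override (x s) (z s)).
Proof.
move=> acx acz e e0; have e20 : 0 < e / 2 by exact: divr_gt0.
have [d1 d10 xd] := acx _ e20; have [d2 d20 zd] := acz _ e20.
exists (Num.min d1 d2) => [|N p q pq tI]; first by rewrite lt_min d10.
rewrite lt_min => /andP[sd1 sd2]; rewrite (splitr e).
apply: le_lt_trans (ltrD (xd _ _ _ pq tI sd1) (zd _ _ _ pq tI sd2)).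
rewrite -big_split/=; apply: ler_sum => i _.
apply: le_trans (override_dist _ _ _ _) _.
by rewrite ge_max lerDl lerDr !normr_ge0.
Qed.

End Override.

Lemma row_mx_coord_measurable (R : realType) (D : set R) m1 m2
    (x : R -> 'rV[R]_m1) (y : R -> 'rV[R]_m2) :
  coord_measurable D x -> coord_measurable D y ->
  coord_measurable D (fun s => row_mx (x s) (y s)).
Proof.
move=> mx my j; under eq_fun do rewrite mxE.
by case: (fintype.split j) => i; [exact: mx|exact: my].
Qed.

(** The three arguments are concatenated into a single vector, on which F is
    uniformly continuous relative to the states with inputs in U and D. *)
Lemma dynamics_coord_measurable (R : realType) n nu nd (U : set 'rV[R]_nu)
    (D : set 'rV[R]_nd) (F : 'rV[R]_n -> 'rV[R]_nu -> 'rV[R]_nd -> 'rV[R]_n)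
    (I : set R) (z : R -> 'rV[R]_n) (u : R -> 'rV[R]_nu) (d : R -> 'rV[R]_nd) :
  regular_dynamics U D F ->
  (forall s, I s -> U (u s)) -> (forall s, I s -> D (d s)) ->
  coord_measurable I z -> coord_measurable I u -> coord_measurable I d ->
  coord_measurable I (fun s => F (z s) (u s) (d s)).
Proof.
move=> [Fuc _ _] IU ID mz mu md i.
pose h (x : 'rV[R]_(n + nu + nd)) :=
  F (lsubmx (lsubmx x)) (rsubmx (lsubmx x)) (rsubmx x) 0 i.
pose A : set 'rV[R]_(n + nu + nd) :=
  [set x | U (rsubmx (lsubmx x)) /\ D (rsubmx x)].
pose v s := row_mx (row_mx (z s) (u s)) (d s).
rewrite (_ : (fun s => _) = h \o v); last first.
  by apply/funext => s; rewrite /h /v /= !row_mxKl !row_mxKr.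
apply: (@coord_measurable_comp _ _ _ A).
- by apply: row_mx_coord_measurable => //; exact: row_mx_coord_measurable.
- move=> s Is; split; rewrite /v ?row_mxKl row_mxKr; [exact: IU|exact: ID].
move=> x [Ux Dx] e /Fuc[dl dl0 Fdl]; exists dl => // x' [Ux' Dx'] xx'.
have := rV_norm_coord (F (lsubmx (lsubmx x')) (rsubmx (lsubmx x')) (rsubmx x') -
  F (lsubmx (lsubmx x)) (rsubmx (lsubmx x)) (rsubmx x)) i.
rewrite !mxE => /le_lt_trans; apply; apply: Fdl => //; rewrite -!linearB/=;
  by apply: le_lt_trans xx'; apply: rV_norm_reindex => j; rewrite !mxE.
Qed.

(** The subsystem is the block of coordinates selected by [pi]. Solving for the
    full state y, instead of only for the missing coordinates, avoids a second
    index type: the coordinates of y in the image of [pi] are discarded. *)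
Lemma lift_trajectory (R : realType) k n nu nd (pi : 'I_k -> 'I_n)
    (U : set 'rV[R]_nu) (D : set 'rV[R]_nd)
    (F : 'rV[R]_n -> 'rV[R]_nu -> 'rV[R]_nd -> 'rV[R]_n)
    (G : 'rV[R]_k -> 'rV[R]_nu -> 'rV[R]_nd -> 'rV[R]_k)
    (t : R) (u : R -> 'rV[R]_nu) (d : R -> 'rV[R]_nd) (z : 'rV[R]_n)
    (xi : R -> 'rV[R]_k) :
  injective pi -> regular_dynamics U D F ->
  (forall z u d, U u -> D d -> colsub pi (F z u d) = G (colsub pi z) u d) ->
  t <= 0 -> input_signal t U u -> input_signal t D d ->
  is_trajectory G (colsub pi z) t u d xi ->
  exists2 zeta, is_trajectory F z t u d zeta &
    forall s, colsub pi (zeta s) = xi s.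
Proof.
move=> pi_inj rF FG t0 [mu uU] [md dD] [acxi xit xi'].
have [Fuc [M FM] _] := rF.
have mxi := absolutely_continuous_coord_measurable acxi.
pose g s y := F (override pi (xi s) y) (u s) (d s).
have [||| y [acy yt y']] := @peano_caratheodory R t 0 M n g z t0.
- by move=> s y sI; apply: FM; [exact: uU|exact: dD].
- move=> e /Fuc[dl dl0 Fdl]; exists dl => // s y y' sI yy'.
  have [Us Ds] := (uU _ sI, dD _ sI).
  apply: Fdl => //; rewrite ?subrr ?normr0//.
  by apply: le_lt_trans (override_dist _ _ _ _ _) _;
    rewrite subrr normr0 gt_max dl0.
- move=> p mp; apply: (dynamics_coord_measurable rF) => //.
  + exact: override_coord_measurable.
  + exact: borel_coord_measurable.
  + exact: borel_coord_measurable.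
exists (fun s => override pi (xi s) (y s)); last first.
  by move=> s; exact: colsub_override.
split; first exact: override_absolutely_continuous.
  by rewrite yt xit override_colsub.
apply: filterS2 xi' y'.
  exact: (ae_filter_ringOfSetsType (@lebesgue_measure R)).
move=> s /[swap] /[dup] ys + xis sI => /(_ sI)/is_derive_rV y's.
move: xis => /(_ sI)/is_derive_rV xi's; apply/is_derive_rV => j.
have [Us Ds] := (uU _ sI, dD _ sI).
under eq_fun do rewrite mxE; case: pickP => [i /eqP <-|_]; last exact: y's.
have := congr1 (fun w : 'rV_k => w 0 i)
  (FG (override pi (xi s) (y s)) _ _ Us Ds).
by rewrite mxE colsub_override// => ->; exact: xi's.
Qed.

(** A strategy against the full system is one against the subsystem, so the
    control that answers it for the subsystem also answers it for the full
    system. *)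
Lemma max_brs_lift (R : realType) k n nu nd (pi : 'I_k -> 'I_n)
    (U : set 'rV[R]_nu) (D : set 'rV[R]_nd)
    (F : 'rV[R]_n -> 'rV[R]_nu -> 'rV[R]_nd -> 'rV[R]_n)
    (G : 'rV[R]_k -> 'rV[R]_nu -> 'rV[R]_nd -> 'rV[R]_k)
    (t : R) (S : set 'rV[R]_k) :
  injective pi -> regular_dynamics U D F ->
  (forall z u d, U u -> D d -> colsub pi (F z u d) = G (colsub pi z) u d) ->
  t <= 0 ->
  colsub pi @^-1` max_brs G U D S t `<=` max_brs F U D (colsub pi @^-1` S) t.
Proof.
move=> pi_inj rF FG t0 z zS gamma nagamma.
have [u [xi [uU xit xiS]]] := zS gamma nagamma.
have [zeta zetat zetaxi] :=
  lift_trajectory pi_inj rF FG t0 uU (nagamma.1 u uU) xit.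
by exists u, zeta; split => //=; rewrite zetaxi.
Qed.

(** * The two subsystems as blocks of coordinates *)

Section SubsystemCoordinates.
Variables (n1 n2 nc : nat).

Definition coord1c (i : 'I_(n1 + nc)) : 'I_(n1 + n2 + nc) :=
  match fintype.split i with inl a => lshift nc (lshift n2 a)
  | inr c => rshift (n1 + n2) c end.

Definition coord2c (i : 'I_(n2 + nc)) : 'I_(n1 + n2 + nc) :=
  match fintype.split i with inl a => lshift nc (rshift n1 a)
  | inr c => rshift (n1 + n2) c end.

Lemma coord1c_inj : injective coord1c.
Proof.
move=> i j; rewrite /coord1c => ij; apply: (can_inj (@fintype.splitK _ _)).
case: (fintype.split i) (fintype.split j) ij => [a|a] [b|b] /eqP;
by rewrite ?eq_shift// => /eqP ->.
Qed.

Lemma coord2c_inj : injective coord2c.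
Proof.
move=> i j; rewrite /coord2c => ij; apply: (can_inj (@fintype.splitK _ _)).
case: (fintype.split i) (fintype.split j) ij => [a|a] [b|b] /eqP;
by rewrite ?eq_shift// => /eqP ->.
Qed.

Lemma colsub_coord1c (R : realType) (z : 'rV[R]_(n1 + n2 + nc)) :
  colsub coord1c z = row_mx (part1 z) (partc z).
Proof.
by apply/rowP => i; rewrite !mxE /coord1c;
  case: (fintype.split i) => a; rewrite !mxE.
Qed.

Lemma colsub_coord2c (R : realType) (z : 'rV[R]_(n1 + n2 + nc)) :
  colsub coord2c z = row_mx (part2 z) (partc z).
Proof.
by apply/rowP => i; rewrite !mxE /coord2c;
  case: (fintype.split i) => a; rewrite !mxE.
Qed.

End SubsystemCoordinates.

Unset Implicit Arguments.
Set Strict Implicit.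

Theorem corollary3 (R : realType) (n1 n2 nc nu nd : nat)
    (hn1 : (0 < n1)%N) (hn2 : (0 < n2)%N)
    (U : set 'rV[R]_nu) (hU : compact U)
    (D : set 'rV[R]_nd) (hD : bounded_set D)
    (f : 'rV[R]_(n1 + n2 + nc) -> 'rV[R]_nu -> 'rV[R]_nd ->
         'rV[R]_(n1 + n2 + nc))
    (hf : regular_dynamics U D f)
    (f1 : 'rV[R]_n1 -> 'rV[R]_nc -> 'rV[R]_nu -> 'rV[R]_nd -> 'rV[R]_n1)
    (f2 : 'rV[R]_n2 -> 'rV[R]_nc -> 'rV[R]_nu -> 'rV[R]_nd -> 'rV[R]_n2)
    (fc : 'rV[R]_nc -> 'rV[R]_nu -> 'rV[R]_nd -> 'rV[R]_nc)
    (hdec : decomposes U D f f1 f2 fc)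
    (t : R) (ht : t < 0)
    (T : set 'rV[R]_(n1 + n2 + nc))
    (T1 : set 'rV[R]_(n1 + nc)) (T2 : set 'rV[R]_(n2 + nc))
    (hT : T = back_proj1 T1 `|` back_proj2 T2) :
  back_proj1 (max_brs (subsystem f1 fc) U D T1 t) `|`
  back_proj2 (max_brs (subsystem f2 fc) U D T2 t)
    `<=` max_brs f U D T t.
Proof.
have max_brs_mono (S : set 'rV[R]_(n1 + n2 + nc)) :
    S `<=` T -> max_brs f U D S t `<=` max_brs f U D T t.
  move=> ST z zS gamma nag; have [u [zeta [uU tz Sz]]] := zS gamma nag.
  by exists u, zeta; split => //; exact: ST.
move=> z [z1|z2].
- apply: (max_brs_mono (colsub (@coord1c n1 n2 nc) @^-1` T1)).
    by move=> w; rewrite hT /= colsub_coord1c; left.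
  apply: (max_brs_lift (@coord1c_inj _ _ _) hf _ (ltW ht)); last first.
    by rewrite /= colsub_coord1c; exact: z1.
  move=> w u d Uu Dd; have [f1E _ fcE] := hdec w u d Uu Dd.
  by rewrite !colsub_coord1c /subsystem row_mxKl row_mxKr f1E fcE.
- apply: (max_brs_mono (colsub (@coord2c n1 n2 nc) @^-1` T2)).
    by move=> w; rewrite hT /= colsub_coord2c; right.
  apply: (max_brs_lift (@coord2c_inj _ _ _) hf _ (ltW ht)); last first.
    by rewrite /= colsub_coord2c; exact: z2.
  move=> w u d Uu Dd; have [_ f2E fcE] := hdec w u d Uu Dd.
  by rewrite !colsub_coord2c /subsystem row_mxKl row_mxKr f2E fcE.
Qed.
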